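(* Let $W=\{(W_i,\omega_i)\}_{i\in I}$ be a fusion Riesz basis for $\mathcal{H}$, and let $W'=\{(W_i,1)\}_{i\in I}$ be the corresponding $1$-uniform family. The following are equivalent: (1) $W$ is a fusion orthonormal basis. (2) $\mathcal{G}_{W}$ is the identity operator on $\left(\sum_{i\in I}\bigoplus W_i\right)_{\ell^2}$. (3) $\mathcal{G}_{W'}$ is the identity operator on $\left(\sum_{i\in I}\bigoplus W_i\right)_{\ell^2}$.
   Context: $\mathcal{H}$ is a separable Hilbert space, $I$ a countable index set, and $\pi_X$ denotes the orthogonal projection onto a closed subspace $X$. For closed subspaces $W_i\subseteq\mathcal{H}$, $\left(\sum_{i\in I}\bigoplus W_i\right)_{\ell^2}$ is the Hilbert space of all $\{f_i\}_{i\in I}$ with $f_i\in W_i$, $\sum_i\|f_i\|^2<\infty$, with inner product $\sum_i\langle f_i,g_i\rangle$. A family $W=\{(W_i,\omega_i)\}_{i\in I}$ of closed subspaces with weights $\omega_i>0$ is a fusion frame for $\mathcal{H}$ if there are $0<A_W\le B_W<\infty$ with $A_W\|f\|^2\le\sum_i\omega_i^2\|\pi_{W_i}f\|^2\le B_W\|f\|^2$ for all $f\in\mathcal{H}$. Its synthesis operator is $T_W:\left(\sum_i\bigoplus W_i\right)_{\ell^2}\to\mathcal{H}$, $T_W\{f_i\}=\sum_i\omega_if_i$, with adjoint (analysis operator) $T_W^*f=\{\omega_i\pi_{W_i}f\}_{i\in I}$; its frame operator is $S_W=T_WT_W^*$, i.e. $S_Wf=\sum_i\omega_i^2\pi_{W_i}f$,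 which is bounded, positive and invertible. A fusion frame $W$ is a fusion orthonormal basis if $\mathcal{H}=\bigoplus_{i\in I}W_i$ (orthogonal direct sum). A family $\{(W_i,\omega_i)\}_{i\in I}$ of closed subspaces with weights $\omega_i>0$ is a fusion Riesz basis for $\mathcal{H}$ if the closed linear span of the $W_i$ is $\mathcal{H}$ and there are $0<C\le D<\infty$ such that for every finite $J\subseteq I$ and all $f_j\in W_j$ ($j\in J$), $C\sum_{j\in J}\|f_j\|^2\le\left\|\sum_{j\in J}\omega_jf_j\right\|^2\le D\sum_{j\in J}\|f_j\|^2$. For a fusion frame $W$, $\phi_{WW}$ is the operator on $\left(\sum_i\bigoplus W_i\right)_{\ell^2}$ given by $\phi_{WW}\{f_i\}=\{\pi_{W_i}S_W^{-1}f_i\}$, and the fusion Gram matrix of $W$ is $\mathcal{G}_W=\phi_{WW}T_W^*T_W$. $\mathcal{G}_{W'}$ is defined in the same way from $W'$ (all weights equal to $1$). *)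

(* Defs.v *)
From HB Require Import structures.
From mathcomp Require Import all_boot all_order all_algebra.
From mathcomp Require Import finmap complex.
From mathcomp Require Import all_classical all_reals all_analysis.
From mathcomp.analysis Require Import showcase.summability.

Set Implicit Arguments.
Unset Strict Implicit.
Unset Printing Implicit Defensive.

Import Order.TTheory GRing.Theory Num.Theory.
Import numFieldNormedType.Exports.

Local Open Scope classical_set_scope.
Local Open Scope ring_scope.

(* Hilbert spaces are real or complex: the scalar field is R or R[i].
   In R[i] the order of MathComp satisfies 0 <= z iff z is real and
   nonnegative, so positive weights, frame bounds and squared norms are
   written as scalars. *)
Variant scalar_kind := RealScalars | ComplexScalars.

Definition scalars (R : realType) (k : scalar_kind) : numFieldType :=
  match k with RealScalars => R | ComplexScalars => R[i] end.

Definition scalar_conj (R : realType) (k : scalar_kind) :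
    involutive_rmorphism (scalars R k) :=
  match k with
  | RealScalars => idfun : involutive_rmorphism R
  | ComplexScalars => @Num.conj R[i] : involutive_rmorphism R[i]
  end.

Definition separable (T : topologicalType) : Prop :=
  exists2 D : set T, countable D & dense D.

Definition closed_subspace (K : numFieldType) (H : normedModType K)
    (X : set H) : Prop :=
  closed X /\ GRing.submod_closed [in X].

Definition linear_span (K : numFieldType) (H : normedModType K)
    (A : set H) : set H :=
  smallest [set X : set H | GRing.submod_closed [in X]] A.

(* The unordered sum: the family has sum s when its finite partial sums
   converge to s along the directed set of finite subsets of I. *)
Definition has_sum (I : choiceType) (K : numFieldType) (V : normedModType K)
    (x : I -> V) (s : V) : Prop :=
  partial_sum x @ totally --> s.

Section FusionFrames.
Context (R : realType) (k : scalar_kind).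
Context (H : completeNormedModType (scalars R k)).
Context (ip : {dot H for scalar_conj R k}).
Context (I : countType).
Local Notation K := (scalars R k).
Implicit Types (W : I -> set H) (w : I -> K) (f : I -> H).

Definition inner_product_of_norm : Prop := forall x : H, `|x| ^+ 2 = ip x x.

Definition orthogonal_subspaces (X Y : set H) : Prop :=
  forall x y, X x -> Y y -> ip x y = 0.

(* Existence and uniqueness of p is the projection theorem. *)
Definition proj (X : set H) (x : H) : H :=
  xget 0 [set p | X p /\ forall y, X y -> ip (x - p) y = 0].

Definition l2_sum W : set (I -> H) :=
  [set f | (forall i, W i (f i)) /\
           exists s : K^o, has_sum (fun i => `|f i| ^+ 2 : K^o) s].

Definition weighted_subspaces W w : Prop :=
  (forall i, closed_subspace (W i)) /\ (forall i, 0 < w i).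

Definition fusion_frame W w : Prop :=
  weighted_subspaces W w /\
  exists A B : K, [/\ 0 < A, A <= B &
    forall x : H, exists2 s : K^o,
      has_sum (fun i => w i ^+ 2 * `|proj (W i) x| ^+ 2 : K^o) s &
      A * `|x| ^+ 2 <= s <= B * `|x| ^+ 2].

(* The (Hilbert space) orthogonal direct sum decomposition H = (+)_i W_i. *)
Definition orthogonal_direct_sum W : Prop :=
  (forall i j, i != j -> orthogonal_subspaces (W i) (W j)) /\
  closure (linear_span (\bigcup_i W i)) = [set: H].

Definition fusion_orthonormal_basis W w : Prop :=
  fusion_frame W w /\ orthogonal_direct_sum W.

Definition fusion_riesz_basis W w : Prop :=
  [/\ weighted_subspaces W w,
      closure (linear_span (\bigcup_i W i)) = [set: H] &
      exists C D : K, [/\ 0 < C, C <= D &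
        forall (J : {fset I}) f, (forall j, j \in J -> W j (f j)) ->
          C * (\sum_(j <- J) `|f j| ^+ 2) <= `|\sum_(j <- J) w j *: f j| ^+ 2
            <= D * (\sum_(j <- J) `|f j| ^+ 2)]].

(* T_W; [sum] is the limit of the finite partial sums. *)
Definition synthesis w f : H := sum (fun i => w i *: f i).

(* T_W^* *)
Definition analysis W w (x : H) : I -> H := fun i => w i *: proj (W i) x.

(* S_W = T_W T_W^* *)
Definition frame_operator W w (x : H) : H := synthesis w (analysis W w x).

(* S_W^-1 : the preimage under S_W, which is bijective for a fusion frame. *)
Definition frame_operator_inv W w (y : H) : H :=
  xget 0 [set x | frame_operator W w x = y].

(* phi_WW *)
Definition phi W w f : I -> H :=
  fun i => proj (W i) (frame_operator_inv W w (f i)).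

(* G_W = phi_WW T_W^* T_W *)
Definition fusion_gram W w f : I -> H :=
  phi W w (analysis W w (synthesis w f)).

Definition identity_on_l2_sum W (G : (I -> H) -> (I -> H)) : Prop :=
  forall f, l2_sum W f -> G f = f.

End FusionFrames.

(* Main.v *)
Require Import Defs.
From mathcomp Require Import all_boot all_order all_algebra.
From mathcomp Require Import finmap complex.
From mathcomp Require Import all_classical all_reals all_analysis.
From mathcomp.analysis Require Import showcase.summability.
From mathcomp Require Import ring.
Set Implicit Arguments.
Unset Strict Implicit.
Unset Printing Implicit Defensive.
Import Order.TTheory GRing.Theory Num.Theory.
Import numFieldNormedType.Exports.
Local Open Scope classical_set_scope.
Local Open Scope ring_scope.

(* If the W_i are orthogonal, the coordinates of S_W and T_W decouple:
   pi_i T_W f = w_i f_i and S_W acts on W_i as w_i^2, for any weights, so the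
   Gram matrix is the identity.  Conversely, feed the Gram matrix a vector x
   concentrated in W_j.  The diagonal entry shows that W_j lies in the range
   of S_W.  For i <> j the vector z with S_W z = w_i pi_i (w_j x) satisfies
   pi_i z = 0, so <S_W z, z> = 0, hence all pi_l z vanish and S_W z = 0: W_i
   is orthogonal to W_j.  Both arguments only use that T_W is bounded, and this
   property passes from (W, w) to (W, 1) because the lower Riesz bound forces
   w_i^2 >= C on every nonzero W_i. *)

#[local] Existing Instance totally_filter.

(* MathComp-Analysis has another [proj]. *)
Local Notation proj := Defs.proj.

(** * Unordered sums and their Cauchy criterion *)

Lemma big_fsetU_setD (M : nmodType) (I : choiceType) (A B : {fset I})
    (F : I -> M) :
  \sum_(i <- (A `|` B)%fset) F i
  = \sum_(i <- A) F i + \sum_(i <- (B `\` A)%fset) F i.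
Proof.
rewrite (big_fsetID _ (mem A)); congr (_ + _); apply: eq_fbigl => i.
  rewrite !inE; by case: (i \in A); rewrite ?andbF ?andbT.
by rewrite !inE; case: (i \in A); rewrite ?andbF ?andbT.
Qed.

Section UnorderedSums.
Context {K : numFieldType} {I : choiceType}.

Lemma partial_sumE (V : zmodType) (x : I -> V) (L : {fset I}) :
  partial_sum x L = \sum_(i <- L) x i.
Proof. by rewrite /partial_sum big_seq_fsetE. Qed.

Lemma has_sumP (V : normedModType K) (x : I -> V) (s : V) :
  has_sum x s <-> forall e : K, 0 < e -> exists J : {fset I},
    forall L : {fset I}, (J `<=` L)%fset -> `|s - \sum_(i <- L) x i| < e.
Proof.
rewrite /has_sum; split.
- move=> /cvgrPdist_lt xs e e0; have [J _ sJ] := xs e e0.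
  by exists J => L JL; rewrite -partial_sumE; apply: sJ.
- move=> xs; apply/cvgrPdist_lt => e e0; have [J sJ] := xs e e0.
  by exists J => // L JL; rewrite /= partial_sumE; apply: sJ.
Qed.

Lemma has_sum_sum (V : normedModType K) (x : I -> V) (s : V) :
  has_sum x s -> sum x = s.
Proof. by move=> xs; apply: cvg_lim => //; apply: norm_hausdorff. Qed.

Lemma has_sum_eventually (V : normedModType K) (x : I -> V) (s c : V)
    (J : {fset I}) : has_sum x s ->
  (forall L : {fset I}, (J `<=` L)%fset -> \sum_(i <- L) x i = c) -> s = c.
Proof.
move=> /has_sumP xs xc; apply/eqP; rewrite -subr_eq0 -normr_le0.
apply/ler_addgt0Pr => e /xs[J' sJ']; rewrite add0r.
by rewrite -(xc (J `|` J')%fset) ?fsubsetUl// ltW// sJ'// fsubsetUr.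
Qed.

Lemma has_sum1 (V : normedModType K) (x : I -> V) (i : I) :
  (forall j, j != i -> x j = 0) -> has_sum x (x i).
Proof.
move=> x0; apply/has_sumP => e e0; exists [fset i]%fset => L.
rewrite fsub1set => iL; rewrite (big_fsetD1 i)//= big1_seq ?addr0 ?subrr ?normr0//.
by move=> j /=; rewrite !inE => /andP[/x0].
Qed.

(** A nonnegative term is at most every partial sum that contains it, and these become arbitrarily
    small. *)
Lemma has_sum_ge0_eq0 (u : I -> K) : (forall i, 0 <= u i) ->
  has_sum (u : I -> K^o) 0 -> forall i, u i = 0.
Proof.
move=> u0 /has_sumP us i; apply/le_anti; rewrite u0 andbT.
apply/ler_addgt0Pr => e /us[J /(_ (i |` J)%fset)]; rewrite [0 + e]add0r.
move=> /(_ (fsubsetU1 _ _)); rewrite sub0r normrN => /ltW; apply: le_trans.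
rewrite (big_fsetD1 i) ?fset1U1//= ger0_norm; last first.
  by rewrite addr_ge0// sumr_ge0.
by rewrite lerDl sumr_ge0.
Qed.

(** The sum over [L] minus [J] is the difference of the partial sums over [J] and over its union
    with [L], both within [e / 2] of [s]. *)
Lemma has_sum_cauchy (V : normedModType K) (x : I -> V) (s : V) :
  has_sum x s -> forall e : K, 0 < e -> exists J : {fset I},
    forall L : {fset I}, `|\sum_(i <- (L `\` J)%fset) x i| < e.
Proof.
move=> /has_sumP xs e e0; have e20 : 0 < e / 2 by rewrite divr_gt0.
have [J sJ] := xs _ e20; exists J => L.
have -> : \sum_(i <- (L `\` J)%fset) x i
    = (s - \sum_(i <- J) x i) - (s - \sum_(i <- (J `|` L)%fset) x i).
  by rewrite big_fsetU_setD opprB [RHS]addrC addrA subrK addrC addKr.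
by rewrite (le_lt_trans (ler_normB _ _))// (splitr e) ltrD// sJ// fsubsetUl.
Qed.

Lemma cauchy_has_sum (V : completeNormedModType K) (x : I -> V) :
  (forall e : K, 0 < e -> exists J : {fset I},
    forall L : {fset I}, `|\sum_(i <- (L `\` J)%fset) x i| < e) ->
  exists s, has_sum x s.
Proof.
move=> xC; have /cauchy_cvg : cauchy (partial_sum x @ totally).
  apply/cauchy_exP => e /xC[J sJ].
  exists (partial_sum x J); exists J => // L /= JL.
  rewrite -ball_normE /ball_/= !partial_sumE -normrN opprB.
  rewrite -(fsetUidPr _ _ JL) big_fsetU_setD.
  by rewrite addrC addKr; apply: sJ.
by move=> /cvg_ex[s xs]; exists s.
Qed.

End UnorderedSums.

(** * Infima and bounded sums of nonnegative real or complex scalars *)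

Section Scalars.
Context {R : realType} {k : scalar_kind}.
Local Notation K := (scalars R k).

Lemma ge0_scalar_conj (a : K) : 0 <= a -> scalar_conj R k a = a.
Proof. by case: k a => a //= a0; apply/CrealP/ger0_real. Qed.

(** The order of [R[i]] is only partial, but nonnegative elements are real, so the infimum is taken
    in [R] and carried back. *)
Lemma ge0_scalar_inf (A : set K) : A !=set0 -> (forall a, A a -> 0 <= a) ->
  exists d : K, (forall a, A a -> d <= a) /\
    forall e, 0 < e -> exists2 a, A a & a < d + e.
Proof.
case: k A => /= A [a0 Aa0] A0.
  have lA : has_lbound A by exists 0 => a /A0.
  exists (inf A); split; first by move=> a; apply: ge_inf.
  by move=> e e0; apply: inf_adherent => //; split=> //; exists a0.
pose B := [set r : R | A (r%:C)%C].
have AB a : A a -> exists2 r, B r & a = (r%:C)%C.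
  move=> Aa; have /complex_realP[r ar] := ger0_real (A0 _ Aa).
  by exists r => //; rewrite /B/= -ar.
have B0 : B !=set0 by have [r Br _] := AB _ Aa0; exists r.
have lB : has_lbound B by exists 0 => r /A0; rewrite lecR.
exists ((inf B)%:C)%C; split.
  by move=> a /AB[r Br ->]; rewrite lecR; apply: ge_inf.
move=> e e0; have /complex_realP[t et] := ger0_real (ltW e0).
move: e0; rewrite et ltcR => t0.
have [r Br rt] := inf_adherent t0 (conj B0 lB).
by exists (r%:C)%C => //; rewrite -rmorphD/= ltcR.
Qed.

Lemma ge0_bounded_has_sum (I : choiceType) (u : I -> K) (B : K) :
  (forall i, 0 <= u i) -> (forall J : {fset I}, \sum_(i <- J) u i <= B) ->
  exists s : K^o, [/\ has_sum (u : I -> K^o) s,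
    forall J : {fset I}, \sum_(i <- J) u i <= s & s <= B].
Proof.
move=> u0 uB.
(* The supremum of the partial sums is obtained as [B - d], where [d] is the infimum of the
   nonnegative gaps below [B]. *)
pose A := [set B - \sum_(i <- J) u i | J in [set: {fset I}]].
have [|a [J _ <-]|d [dA Ad]] := @ge0_scalar_inf A.
- by exists (B - \sum_(i <- fset0) u i); exists fset0.
- by rewrite subr_ge0.
have us (J : {fset I}) : \sum_(i <- J) u i <= B - d.
  by rewrite lerBrDr -lerBrDl; apply: dA; exists J.
exists (B - d); split => //; last first.
  rewrite gerBl; apply/ler_addgt0Pr => e /Ad[_ [J _ <-] Jd].
  by rewrite (le_trans _ (ltW Jd))// subr_ge0.
apply/has_sumP => e /Ad[_ [J _ <-] Jd]; exists J => L JL.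
rewrite ger0_norm ?subr_ge0//.
rewrite -(fsetUidPr _ _ JL) big_fsetU_setD.
apply: (@le_lt_trans _ _ (B - d - \sum_(i <- J) u i)).
  by rewrite lerD2l lerN2 lerDl sumr_ge0.
by rewrite addrAC ltrBlDl.
Qed.

End Scalars.

(** * Inner product inequalities and orthogonal projections *)

Section Hilbert.
Context {R : realType} {k : scalar_kind}.
Local Notation K := (scalars R k).
Context {H : completeNormedModType K}.
Context {ip : {dot H for scalar_conj R k}}.
Hypothesis ip_norm : inner_product_of_norm ip.
Implicit Types (x y z : H) (X : set H).

Lemma ipC x y : ip x y = scalar_conj R k (ip y x).
Proof. by rewrite hermC expr0 mul1r. Qed.

Lemma ipZl (a : K) x y : ip (a *: x) y = a * ip x y.
Proof. exact: linearZl_LR. Qed.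

Lemma ipZr (a : K) x y : ip x (a *: y) = scalar_conj R k a * ip x y.
Proof. by rewrite ipC ipZl rmorphM/= -ipC. Qed.

Lemma ip0C x y : ip x y = 0 -> ip y x = 0.
Proof. by move=> xy; rewrite ipC xy rmorph0. Qed.

Lemma pythagoras x y : ip x y = 0 -> `|x + y| ^+ 2 = `|x| ^+ 2 + `|y| ^+ 2.
Proof. by move=> xy; rewrite !ip_norm hnormDd. Qed.

Lemma parallelogram x y :
  `|x + y| ^+ 2 + `|x - y| ^+ 2 = 2 * (`|x| ^+ 2 + `|y| ^+ 2).
Proof.
rewrite !ip_norm !(linearDl, linearNl, linearDr, linearNr) /=.
by ring.
Qed.

(** Pythagoras for the component of [x] along [y], multiplied by [|y|^2] so that [y = 0] is covered.
    It yields Cauchy-Schwarz and measures how much a step along [y] shortens [x]. *)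
Lemma ip_residual x y : exists t : K,
  `|x - t *: y| ^+ 2 * `|y| ^+ 2 + `|ip x y| ^+ 2 = `|x| ^+ 2 * `|y| ^+ 2.
Proof.
have [->|y0] := eqVneq y 0.
  by exists 0; rewrite linear0r !normr0 expr0n/= !mulr0 addr0.
have n0 : `|y| ^+ 2 != 0 by rewrite expf_neq0// normr_eq0.
pose t := ip x y / `|y| ^+ 2; exists t.
have tE : `|t *: y| ^+ 2 * `|y| ^+ 2 = `|ip x y| ^+ 2.
  rewrite normrZ /t normrM normfV normrX normr_id.
  by rewrite -exprMn -mulrA -expr2 divfK.
have xty : ip (x - t *: y) (t *: y) = 0.
  by rewrite ipZr linearBl/= ipZl -ip_norm /t divfK// subrr mulr0.
by rewrite -tE -mulrDl -pythagoras// subrK.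
Qed.

Lemma cauchy_schwarz_sqr x y : `|ip x y| ^+ 2 <= `|x| ^+ 2 * `|y| ^+ 2.
Proof.
have [t <-] := ip_residual x y.
by rewrite lerDr mulr_ge0// exprn_ge0.
Qed.

Lemma cauchy_schwarz x y : `|ip x y| <= `|x| * `|y|.
Proof.
by rewrite -ler_sqr ?nnegrE ?mulr_ge0// exprMn cauchy_schwarz_sqr.
Qed.

Lemma has_sum_ip (I : choiceType) (f : I -> H) (s y : H) :
  has_sum f s -> has_sum (fun i => ip (f i) y : K^o) (ip s y : K^o).
Proof.
move=> /has_sumP fs; apply/has_sumP => e e0.
(* Adding 1 keeps the divisor positive when [y = 0]. *)
have y1 : 0 < `|y| + 1 by rewrite ltr_wpDl.
have [|J sJ] := fs (e / (`|y| + 1)); first by rewrite divr_gt0.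
exists J => L /sJ; rewrite ltr_pdivlMr// -linear_sumlz -linearBl/=.
apply: le_lt_trans; apply: (le_trans (cauchy_schwarz _ _)).
by rewrite ler_wpM2l// lerDl.
Qed.

Lemma closed_subspace0 X : closed_subspace X -> X 0.
Proof. by move=> [_ []]; rewrite in_setE. Qed.

Lemma closed_subspaceP X (a : K) x y :
  closed_subspace X -> X x -> X y -> X (a *: x + y).
Proof.
by move=> [_ [_ +]] Xx Xy => /(_ a x y); rewrite !in_setE; apply.
Qed.

Lemma closed_subspaceZ X (a : K) x : closed_subspace X -> X x -> X (a *: x).
Proof.
move=> cX Xx; rewrite -[_ *: _]addr0; apply: closed_subspaceP => //.
exact: closed_subspace0.
Qed.

Lemma closed_subspaceB X x y : closed_subspace X -> X x -> X y -> X (x - y).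
Proof.
by move=> cX Xx Xy; rewrite addrC -scaleN1r; apply: closed_subspaceP.
Qed.

(* No z in X can improve on the distance from x to y by more than e^2, which
   bounds the gain |<x - y, z>|^2 / |z|^2 of [ip_residual]. *)
Lemma minimizing_ip (X : set H) x y z (d e : K) : closed_subspace X ->
  (forall u, X u -> d <= `|x - u| ^+ 2) -> X y -> `|x - y| ^+ 2 < d + e ^+ 2 ->
  0 < e -> X z -> `|ip (x - y) z| <= e * `|z|.
Proof.
move=> cX dX Xy xyd e0 Xz; rewrite -ler_sqr ?nnegrE ?mulr_ge0// ?(ltW e0)//.
have [t tE] := ip_residual (x - y) z.
rewrite exprMn -(lerD2l (d * `|z| ^+ 2)) -mulrDl.
apply: (@le_trans _ _ (`|x - y| ^+ 2 * `|z| ^+ 2)); last first.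
  by rewrite ler_wpM2r ?exprn_ge0// ltW.
rewrite -tE lerD2r ler_wpM2r ?exprn_ge0//.
by rewrite -addrA -opprD [y + _]addrC dX//; apply: closed_subspaceP.
Qed.

(** The sets [G e] of near-minimizers of the distance to [x] generate a Cauchy filter; its limit
    lies in the closed set [X], and near-minimizers are almost orthogonal to [X] after subtraction
    from [x]. *)
Lemma projection_theorem X x : closed_subspace X ->
  exists p, X p /\ forall y, X y -> ip (x - p) y = 0.
Proof.
move=> cX.
have [||d [dX Xd]] := @ge0_scalar_inf R k [set `|x - y| ^+ 2 | y in X].
- by exists (`|x - 0| ^+ 2); exists 0 => //; apply: closed_subspace0.
- by move=> _ [y _ <-]; rewrite exprn_ge0.
have {}dX u : X u -> d <= `|x - u| ^+ 2 by move=> Xu; apply: dX; exists u.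
pose G (e : K) := [set y | X y /\ `|x - y| ^+ 2 < d + e ^+ 2].
have G0 e : 0 < e -> G e !=set0.
  move=> e0; have [|_ [y Xy <-] xyd] := Xd (e ^+ 2); first by rewrite exprn_gt0.
  by exists y.
pose F := filter_from [set e : K | 0 < e] G.
have FF : ProperFilter F.
  apply: filter_from_proper => //; apply: filter_from_filter; first by exists 1 => /=.
  (* The witness is a positive scalar below both [a] and [b], given by a formula that compares
     neither with the other. *)
  move=> a b /= a0 b0; have [a1 b1] := (ltW a0, ltW b0); exists (a * b / (a + b)).
    by rewrite /= divr_gt0 ?mulr_gt0 ?addr_gt0.
  have ab0 : 0 < a + b by rewrite addr_gt0.
  have le_a : a * b / (a + b) <= a.
    by rewrite ler_pdivrMr// ler_wpM2l ?lerDr.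
  have le_b : a * b / (a + b) <= b.
    by rewrite ler_pdivrMr// mulrC ler_wpM2l ?lerDl.
  have ab : 0 <= a * b / (a + b) by rewrite ltW// divr_gt0 ?mulr_gt0.
  move=> y [Xy xyd]; split; split=> //; apply: (lt_le_trans xyd);
    by rewrite lerD2l ler_sqr ?nnegrE// ltW.
have /cauchy_cvg/cvg_ex[/= p Fp] : cauchy F.
  apply/cauchy_exP => e e0; have e20 : 0 < e / 2 by rewrite divr_gt0.
  have [y [Xy xyd]] := G0 _ e20; exists y; exists (e / 2) => // z [Xz xzd].
  rewrite -ball_normE /ball_/=.
  rewrite -ltr_sqr ?nnegrE// ?ltW//.
  (* The midpoint of [y] and [z] lies in [X], hence has squared distance at least [d] from [x]; the
     parallelogram law then bounds [|z - y|^2] by less than [4 (e / 2)^2 = e^2]. *)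
  have Xm : X (2^-1 *: (y + z)).
    apply: closed_subspaceZ => //.
    by rewrite -[y]scale1r; apply: closed_subspaceP.
  have mE : `|(x - y) + (x - z)| ^+ 2 = 4 * `|x - 2^-1 *: (y + z)| ^+ 2.
    have -> : (x - y) + (x - z) = 2 *: (x - 2^-1 *: (y + z)).
      by rewrite scalerBr scalerA divff// scale1r scaler_nat mulr2n opprD addrACA.
    by rewrite normrZ exprMn ger0_norm// -natrX.
  have := parallelogram (x - y) (x - z); rewrite mE.
  have -> : x - y - (x - z) = z - y by rewrite opprB addrC addrA subrK.
  rewrite (distrC z) => /(canRL (addKr _)) ->.
  have {}mE := dX _ Xm.
  apply: (@le_lt_trans _ _ (- (4 * d) + 2 * (`|x - y| ^+ 2 + `|x - z| ^+ 2))).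
    by rewrite lerD2r lerN2 ler_wpM2l.
  have -> : e ^+ 2 = - (4 * d) + 2 * ((d + (e / 2) ^+ 2) + (d + (e / 2) ^+ 2)).
    by rewrite expr_div_n; field.
  by rewrite ltrD2l ltr_pM2l// ltrD.
exists p; split.
  rewrite (closure_id X).1; last by case: cX.
  move=> B /Fp[e /= e0 GB]; have [y Gy] := G0 _ e0.
  by exists y; split; [case: Gy|apply: GB].
move=> z Xz; apply/eqP; rewrite -normr_le0; apply/ler_addgt0Pr => e e0.
(* With a near-minimizer [y] within [b] of [p], both [<x - y, z>] and [<p - y, z>] are at most
   [b |z|], and [b] makes the total at most [e]. *)
rewrite add0r; pose b := e / 2 / (`|z| + 1).
have z1 : 0 < `|z| + 1 by rewrite ltr_wpDl.
have b0 : 0 < b by rewrite !divr_gt0.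
have [y [pyb [Xy xyd]]] : (ball p b `&` G b) !=set0.
  apply: (@filter_ex _ F); apply: filterI; last by exists b.
  by apply: Fp; apply: nbhsx_ballx.
move: pyb; rewrite -ball_normE /ball_/= => pyb.
have -> : x - p = (x - y) - (p - y) by rewrite opprB addrA subrK.
rewrite linearBl/= (le_trans (ler_normB _ _))//.
have -> : e = b * (`|z| + 1) + b * (`|z| + 1).
  by rewrite /b divfK ?gt_eqF// -splitr.
have zb : b * `|z| <= b * (`|z| + 1) by rewrite ler_wpM2l ?lerDl// ltW.
apply: lerD; first exact: le_trans (minimizing_ip cX dX Xy xyd b0 Xz) zb.
apply: le_trans zb; apply: (le_trans (cauchy_schwarz _ _)).
by rewrite ler_wpM2r// ltW.
Qed.

Lemma proj_in X x : closed_subspace X -> X (proj ip X x).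
Proof. by move=> /(projection_theorem x)/(xgetPex 0)[]. Qed.

Lemma ip_projB X x y : closed_subspace X -> X y -> ip (x - proj ip X x) y = 0.
Proof. by move=> /(projection_theorem x)/(xgetPex 0)[_]; apply. Qed.

Lemma ip_proj X x y : closed_subspace X -> X y -> ip (proj ip X x) y = ip x y.
Proof.
by move=> cX Xy; apply/esym/eqP; rewrite -subr_eq0 -linearBl/= ip_projB.
Qed.

(** The difference of the two candidates lies in [X] and is orthogonal to [X], hence to itself. *)
Lemma proj_unique X x p : closed_subspace X -> X p ->
  (forall y, X y -> ip x y = ip p y) -> proj ip X x = p.
Proof.
move=> cX Xp xp; apply/eqP; rewrite -subr_eq0 -normr_eq0 -sqrf_eq0 ip_norm.
have Xd : X (proj ip X x - p) by apply: closed_subspaceB => //; apply: proj_in.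
by rewrite linearBl/= ip_proj// xp// subrr.
Qed.

Lemma ip_proj_self X x : closed_subspace X ->
  ip (proj ip X x) x = `|proj ip X x| ^+ 2.
Proof.
move=> cX; rewrite ipC -(ip_proj _ cX (proj_in x cX)) -ip_norm.
by rewrite ge0_scalar_conj// exprn_ge0.
Qed.

Lemma proj_id X x : closed_subspace X -> X x -> proj ip X x = x.
Proof. by move=> cX Xx; apply: proj_unique. Qed.

Lemma proj_eq0 X x : closed_subspace X -> (forall y, X y -> ip x y = 0) ->
  proj ip X x = 0.
Proof.
move=> cX x0; apply: proj_unique => //; first exact: closed_subspace0.
by move=> y /x0 ->; rewrite linear0l.
Qed.

Lemma proj_linear X (a : K) x y : closed_subspace X ->
  proj ip X (a *: x + y) = a *: proj ip X x + proj ip X y.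
Proof.
move=> cX; apply: proj_unique => //.
  by apply: closed_subspaceP => //; apply: proj_in.
by move=> z Xz; rewrite !linearDl/= !ipZl !ip_proj.
Qed.

End Hilbert.

(** * Families of closed subspaces and vectors concentrated in one of them *)

Section FusionFrames.
Context {R : realType} {k : scalar_kind}.
Local Notation K := (scalars R k).
Context {H : completeNormedModType K}.
Context {ip : {dot H for scalar_conj R k}}.
Hypothesis ip_norm : inner_product_of_norm ip.
Context {I : countType} {W : I -> set H}.
Hypothesis cW : forall i, closed_subspace (W i).

(** The upper half of the Riesz inequality: on finitely supported families the synthesis operator
    has squared norm at most [D]. *)
Definition synthesis_bound (v : I -> K) (D : K) :=
  forall (J : {fset I}) (f : I -> H), (forall j, j \in J -> W j (f j)) ->
    `|\sum_(j <- J) v j *: f j| ^+ 2 <= D * (\sum_(j <- J) `|f j| ^+ 2).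

Definition pairwise_orthogonal_subspaces :=
  forall i j, i != j -> orthogonal_subspaces ip (W i) (W j).

Definition single (i : I) (x : H) : I -> H :=
  fun j => if j == i then x else 0.

Lemma single_id i x : single i x i = x.
Proof. by rewrite /single eqxx. Qed.

Lemma single_neq i j x : j != i -> single i x j = 0.
Proof. by rewrite /single => /negPf ->. Qed.

Lemma l2_sum_single i x : W i x -> l2_sum W (single i x).
Proof.
move=> Wx; split.
  move=> j; rewrite /single; case: eqP => [->//|_]; exact: closed_subspace0.
exists (`|single i x i| ^+ 2).
apply: (@has_sum1 K I K^o (fun j => `|single i x j| ^+ 2)) => j ji.
by rewrite single_neq// normr0 expr0n.
Qed.

Lemma synthesis_single (v : I -> K) i x : synthesis v (single i x) = v i *: x.
Proof.
rewrite /synthesis.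
have := @has_sum1 K I H (fun j => v j *: single i x j) i.
rewrite single_id => /(_ _)/has_sum_sum; apply => j ji.
by rewrite single_neq// scaler0.
Qed.

Lemma proj_orthogonal i j x : pairwise_orthogonal_subspaces -> j != i ->
  W j x -> proj ip (W i) x = 0.
Proof. by move=> oW ji Wx; apply: proj_eq0 => // y Wy; apply: (oW j i). Qed.

Lemma norm_sum_orthogonal (f : I -> H) (J : {fset I}) :
  pairwise_orthogonal_subspaces -> (forall i, W i (f i)) ->
  `|\sum_(i <- J) f i| ^+ 2 = \sum_(i <- J) `|f i| ^+ 2.
Proof.
move=> oW Wf; rewrite ip_norm linear_sumlz/= big_seq [RHS]big_seq.
apply: eq_bigr => i iJ; rewrite ip_norm linear_sumr/= (big_fsetD1 i)//=.
rewrite big1_seq ?addr0// => j /=; rewrite !inE => /andP[ji _].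
by apply: (oW i j) => //; rewrite eq_sym.
Qed.

(** * Frame operator and Gram matrix for a bounded synthesis operator *)

Section BoundedSynthesis.
Context {v : I -> K} {D : K}.
Hypotheses (v0 : forall i, 0 < v i) (D0 : 0 < D) (vD : synthesis_bound v D).

(* With q = sum_J v_i^2 |pi_i x|^2 and u = sum_J v_i^2 pi_i x one has
   q = <u, x> and |u|^2 <= D q, so that q^2 <= D q |x|^2. *)
Lemma bessel_bound (J : {fset I}) x :
  \sum_(i <- J) v i ^+ 2 * `|proj ip (W i) x| ^+ 2 <= D * `|x| ^+ 2.
Proof.
set q := \sum_(i <- J) _.
have q0 : 0 <= q by apply: sumr_ge0 => i _; rewrite mulr_ge0 ?exprn_ge0// ltW.
have [->|qn0] := eqVneq q 0.
  by rewrite mulr_ge0 ?exprn_ge0// ltW.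
have qp : 0 < q by rewrite lt_def qn0.
have Wa j : W j (v j *: proj ip (W j) x).
  by apply: closed_subspaceZ => //; apply: proj_in.
have := vD (J := J) (fun j _ => Wa j).
set u := \sum_(j <- J) _.
have -> : \sum_(j <- J) `|v j *: proj ip (W j) x| ^+ 2 = q.
  by apply: eq_bigr => j _; rewrite normrZ exprMn ger0_norm// ltW.
have uxq : ip u x = q.
  rewrite linear_sumlz/=; apply: eq_bigr => j _.
  by rewrite !ipZl ip_proj_self// mulrA.
move=> uD; have := cauchy_schwarz_sqr ip_norm u x; rewrite uxq.
move=> /le_trans/(_ (ler_wpM2r (exprn_ge0 2 (normr_ge0 x)) uD)).
by rewrite ger0_norm// expr2 mulrAC [D * _ * _]mulrC ler_pM2l.
Qed.

(** The squared norm of a tail of the series is at most [D] times the same tail of the sum of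
    [|f i|^2], so completeness gives convergence. *)
Lemma has_sum_synthesis (f : I -> H) : l2_sum W f ->
  has_sum (fun i => v i *: f i) (synthesis v f).
Proof.
move=> [Wf [s fs]].
suff [t ft] : exists t, has_sum (fun i => v i *: f i) t.
  by rewrite /synthesis (has_sum_sum ft).
apply: cauchy_has_sum => e e0.
have [|J sJ] := has_sum_cauchy fs (e := e ^+ 2 / D).
  by rewrite divr_gt0// exprn_gt0.
exists J => L; rewrite -ltr_sqr ?nnegrE ?(ltW e0)//.
apply: le_lt_trans (vD (fun j _ => Wf j)) _.
rewrite mulrC -ltr_pdivlMr//; apply: le_lt_trans (sJ L).
by rewrite ger0_norm// sumr_ge0// => i _; rewrite exprn_ge0.
Qed.

Lemma l2_sum_analysis x : l2_sum W (analysis ip W v x).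
Proof.
split; first by move=> i; apply: closed_subspaceZ => //; apply: proj_in.
have [||s [us _ _]] := @ge0_bounded_has_sum R k I
  (fun i => `|analysis ip W v x i| ^+ 2) (D * `|x| ^+ 2).
- by move=> i; rewrite exprn_ge0.
- move=> J; apply: le_trans (bessel_bound J x).
  rewrite le_eqVlt; apply/orP; left; apply/eqP; apply: eq_bigr => i _.
  by rewrite normrZ exprMn ger0_norm// ltW.
- by exists s.
Qed.

Lemma has_sum_frame_operator x :
  has_sum (fun i => v i *: (v i *: proj ip (W i) x)) (frame_operator ip W v x).
Proof. exact: has_sum_synthesis (l2_sum_analysis x). Qed.

Lemma frame_operator_proj0 x : (forall i, proj ip (W i) x = 0) ->
  frame_operator ip W v x = 0.
Proof.
move=> x0; apply: (has_sum_eventually (J := fset0) (@has_sum_frame_operator x)).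
by move=> L _; rewrite big1// => i _; rewrite x0 !scaler0.
Qed.

(** The pairing of [S x] with [x] is the sum of the nonnegative terms [v_i^2 |pi_i x|^2]; if it
    vanishes, so does every projection of [x]. *)
Lemma ip_frame_operator_eq0 x : ip (frame_operator ip W v x) x = 0 ->
  frame_operator ip W v x = 0.
Proof.
move=> Sx0; apply: frame_operator_proj0 => i.
have := has_sum_ip ip_norm (y := x) (@has_sum_frame_operator x); rewrite Sx0.
have uE j : ip (v j *: (v j *: proj ip (W j) x)) x
    = v j * (v j * `|proj ip (W j) x| ^+ 2).
  by rewrite !ipZl ip_proj_self.
have u0 j : 0 <= ip (v j *: (v j *: proj ip (W j) x)) x.
  by rewrite uE !mulr_ge0 ?exprn_ge0// ltW.
move=> /(has_sum_ge0_eq0 u0)/(_ i)/eqP.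
by rewrite uE !mulf_eq0 gt_eqF//= normr_eq0 orbb => /eqP.
Qed.

Lemma gram_identity_orthogonal :
  identity_on_l2_sum W (fusion_gram ip W v) -> pairwise_orthogonal_subspaces.
Proof.
move=> G1.
have proj0 i : proj ip (W i) 0 = 0.
  by apply: proj_id => //; apply: closed_subspace0.
(* If S_W z = x had no solution, the inverse would take its junk value 0 and
   the diagonal entry of the Gram matrix would vanish. *)
have surj i x : W i x -> exists z, frame_operator ip W v z = x.
  (* The scaling makes coordinate [i] of the analysis of [T (single i y)] equal to [x], so the
     diagonal entry applies the inverse frame operator to [x] itself. *)
  move=> Wx; pose y := (v i * v i)^-1 *: x.
  have Wy : W i y by apply: closed_subspaceZ.
  have vv0 : v i * v i != 0 by rewrite mulf_neq0// gt_eqF.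
  have := congr1 (@^~ i) (G1 _ (l2_sum_single Wy)).
  rewrite /fusion_gram /phi /analysis synthesis_single single_id.
  rewrite [proj _ _ (v i *: y)]proj_id//; last by apply: closed_subspaceZ.
  rewrite scalerA {1}/y scalerA divff// scale1r => xy.
  apply: contrapT => nx; move: xy.
  rewrite /frame_operator_inv xgetPN ?proj0; last first.
    by move=> z zx; apply: nx; exists z.
  move=> /esym/eqP; rewrite scaler_eq0 invr_eq0 (negPf vv0)/= => /eqP x0.
  by apply: nx; exists 0; rewrite x0 frame_operator_proj0.
move=> j i ji x u Wx Wu.
have := congr1 (@^~ i) (G1 _ (l2_sum_single Wx)).
rewrite /fusion_gram /phi /analysis synthesis_single single_neq 1?eq_sym//.
set y := v i *: _; set z := frame_operator_inv _ _ _ _ => z0.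
have Wy : W i y by apply: closed_subspaceZ => //; apply: proj_in.
have Sz : frame_operator ip W v z = y := xgetPex 0 (surj _ _ Wy).
have /eqP : y = 0.
  rewrite -Sz; apply: ip_frame_operator_eq0; rewrite Sz.
  by apply: ip0C; rewrite -(ip_proj ip_norm z (cW i) Wy) z0 linear0l.
rewrite scaler_eq0 gt_eqF//= => /eqP px0.
have /eqP := ip_proj ip_norm (v j *: x) (cW i) Wu.
by rewrite px0 linear0l ipZl eq_sym mulf_eq0 gt_eqF//= => /eqP.
Qed.

(** Pairing the series with a vector of [W i] commutes with the sum and leaves only the term of
    index [i]. *)
Lemma proj_has_sum (f : I -> H) s i : pairwise_orthogonal_subspaces ->
  (forall j, W j (f j)) -> has_sum (fun j => v j *: f j) s ->
  proj ip (W i) s = v i *: f i.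
Proof.
move=> oW Wf fs; apply: proj_unique => //; first by apply: closed_subspaceZ.
move=> y Wy; rewrite -(has_sum_sum (has_sum_ip ip_norm (y := y) fs)).
apply: has_sum_sum; apply: (@has_sum1 K I K^o (fun j => ip (v j *: f j) y)).
by move=> j ji; rewrite ipZl (oW j i)// mulr0.
Qed.

Lemma orthogonal_gram_identity :
  pairwise_orthogonal_subspaces -> identity_on_l2_sum W (fusion_gram ip W v).
Proof.
move=> oW f lf; have [Wf _] := lf; apply/funext => i.
rewrite /fusion_gram /phi {1}/analysis.
rewrite (proj_has_sum i oW Wf (has_sum_synthesis lf)).
set y := v i *: _; set z := frame_operator_inv _ _ _ _.
have Sz : frame_operator ip W v z = y.
  apply: (xgetPex 0 (P := [set x | frame_operator ip W v x = y])).
  (* By orthogonality the frame operator multiplies [f i] by [v_i^2], which gives [y]. *)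
  exists (f i); rewrite /= /frame_operator /synthesis.
  have := @has_sum1 K I H (fun j => v j *: analysis ip W v (f i) j) i.
  rewrite [analysis _ _ _ _ i]/analysis proj_id// => /(_ _)/has_sum_sum; apply => j ji.
  by rewrite /analysis (proj_orthogonal oW _ (Wf i)) ?scaler0// eq_sym.
have Wy : W i y by do 2 apply: closed_subspaceZ => //.
(* The chosen preimage [z] may differ from [f i]; projecting [S z = y] onto [W i] still determines
   its component there, after cancelling [v i] twice. *)
have [Wa _] := l2_sum_analysis z.
have := proj_has_sum i oW Wa (@has_sum_frame_operator z).
rewrite Sz proj_id// => /scalerI; rewrite gt_eqF// => /(_ isT)/scalerI.
by rewrite gt_eqF// => /(_ isT) ->.
Qed.

End BoundedSynthesis.

(** * Approximate Parseval identity for orthogonal direct sums *)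

(** Vectors with this property form a submodule containing every [W i]. Allowing all larger [L] lets
    two vectors share the union of their index sets. *)
Lemma linear_span_sum_proj y : pairwise_orthogonal_subspaces ->
  linear_span (\bigcup_i W i) y -> exists J : {fset I},
    forall L : {fset I}, (J `<=` L)%fset -> y = \sum_(i <- L) proj ip (W i) y.
Proof.
move=> oW.
pose Y := [set y : H | exists J : {fset I}, forall L : {fset I},
  (J `<=` L)%fset -> y = \sum_(i <- L) proj ip (W i) y].
suff : linear_span (\bigcup_i W i) `<=` Y by apply.
apply: smallest_sub.
  split; rewrite ?in_setE.
    exists fset0 => L _; rewrite big1// => i _.
    by apply: proj_id => //; apply: closed_subspace0.
  move=> a u w; rewrite !in_setE => -[J1 uJ] [J2 wJ].
  exists (J1 `|` J2)%fset => L; rewrite fsubUset => /andP[/uJ uL /wJ wL].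
  rewrite {1}uL {1}wL scaler_sumr -big_split; apply: eq_bigr => i _ /=.
  by rewrite proj_linear.
move=> x [i _ Wx]; exists [fset i]%fset => L; rewrite fsub1set => iL.
rewrite (big_fsetD1 i)//= proj_id// big1_seq ?addr0// => j /=.
rewrite !inE => /andP[ji _].
by apply: (proj_orthogonal oW _ Wx); rewrite eq_sym.
Qed.

(** A vector [y] of the span close to [x] is a sum over some [J]; the sum [p] of the projections of
    [x] over [J] is at least as close, and [|x|^2 = |x - p|^2 + |p|^2]. This supplies the lower
    frame bound. *)
Lemma orthogonal_direct_sum_approx x (e : K) : 0 < e ->
  pairwise_orthogonal_subspaces ->
  closure (linear_span (\bigcup_i W i)) = [set: H] ->
  exists J : {fset I},
    `|x| ^+ 2 <= e + \sum_(i <- J) `|proj ip (W i) x| ^+ 2.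
Proof.
(* This radius is below both 1 and [e], so [r^2 <= e] without a square root. *)
move=> e0 oW cl; pose r := e / (1 + e).
have e1 : 0 < 1 + e by rewrite addr_gt0.
have r0 : 0 < r by rewrite divr_gt0.
have re : r ^+ 2 <= e.
  rewrite -[leRHS]mul1r expr2 ler_pM ?(ltW r0)//.
    by rewrite ler_pdivrMr// mul1r lerDr.
  by rewrite ler_pdivrMr// ler_peMr ?lerDl// ltW.
have : closure (linear_span (\bigcup_i W i)) x by rewrite cl.
move=> /(_ _ (nbhsx_ballx x r r0))[y [/(linear_span_sum_proj oW)[J yJ]]].
rewrite -ball_normE /ball_/= => xyr; exists J.
pose p := \sum_(i <- J) proj ip (W i) x.
have Wp i : W i (proj ip (W i) x) by apply: proj_in.
(* [x - p] is orthogonal to every such sum over [J], in particular to [p] and to [p - y]. *)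
have xp (q : I -> H) : (forall i, W i (q i)) ->
    ip (x - p) (\sum_(i <- J) q i) = 0.
  move=> Wq; rewrite linear_sumr/= big1_seq// => i /= iJ.
  rewrite /p (big_fsetD1 i)//= opprD addrA linearBl/= ip_projB// sub0r.
  rewrite linear_sumlz/= big1_seq ?oppr0// => j /=.
  by rewrite !inE => /andP[ji _]; apply: (oW j i).
rewrite -(norm_sum_orthogonal J oW Wp) -[x in X in X <= _](subrK p).
rewrite (pythagoras ip_norm)//; last exact: xp.
rewrite lerD2r; apply: (@le_trans _ _ (`|x - y| ^+ 2)); last first.
  by apply: le_trans re; rewrite ler_sqr ?nnegrE// ltW.
have -> : x - y = (x - p) + (p - y) by rewrite addrA subrK.
rewrite [leRHS](pythagoras ip_norm); first by rewrite lerDl exprn_ge0.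
rewrite [in p - y](yJ J)// /p -sumrB; apply: xp => i.
by apply: closed_subspaceB => //; apply: proj_in.
Qed.

End FusionFrames.

Theorem proposition3p3 (R : realType) (k : scalar_kind)
    (H : completeNormedModType (scalars R k))
    (ip : {dot H for scalar_conj R k})
    (H_hilbert : inner_product_of_norm ip)
    (H_separable : separable H)
    (I : countType) (W : I -> set H) (w : I -> scalars R k)
    (W_riesz : fusion_riesz_basis W w) :
  [<-> fusion_orthonormal_basis ip W w;
       identity_on_l2_sum W (fusion_gram ip W w);
       identity_on_l2_sum W (fusion_gram ip W (fun _ => 1))].
Proof.
have [[cW w0] W_dense [C [D [C0 CD CDW]]]] := W_riesz.
have D0 : 0 < D by apply: lt_le_trans CD.
have wD : synthesis_bound (W := W) w D by move=> J f /CDW/andP[].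
(* The lower Riesz bound on a singleton. The factor [|x|^2] stays because [W i] may be zero. *)
have wC i x : W i x -> C * `|x| ^+ 2 <= w i ^+ 2 * `|x| ^+ 2.
  move=> Wx; have Wj j : j \in [fset i]%fset -> W j x by rewrite inE => /eqP ->.
  have /andP[+ _] := CDW [fset i]%fset (fun=> x) Wj.
  by rewrite !big_seq_fset1 normrZ exprMn ger0_norm// ltW.
(* Writing [f j = w j *: g j] reduces weights 1 to weights [w], and [wC] gives
   [|g j|^2 <= |f j|^2 / C], whence the constant [D / C]. *)
have oneD : synthesis_bound (W := W) (fun=> 1) (D / C).
  move=> J f Wf; pose g j := (w j)^-1 *: f j.
  have Wg j : j \in J -> W j (g j) by move=> /Wf; apply: closed_subspaceZ.
  have wn0 j : w j != 0 by rewrite gt_eqF.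
  have -> : \sum_(j <- J) 1 *: f j = \sum_(j <- J) w j *: g j.
    by apply: eq_bigr => j _; rewrite scale1r scalerA divff// scale1r.
  apply: le_trans (wD J g Wg) _; rewrite -mulrA ler_pM2l//.
  rewrite mulrC ler_pdivlMr// mulr_suml big_seq [leRHS]big_seq.
  apply: ler_sum => j /Wg Wgj; rewrite mulrC.
  apply: le_trans (wC j _ Wgj) _.
  by rewrite normrZ exprMn mulrA -exprMn normfV gtr0_norm// divff// expr1n mul1r.
have DC0 : 0 < D / C by apply: divr_gt0.
tfae.
- by move=> [_ [oW _]]; apply: orthogonal_gram_identity w0 D0 wD oW.
(* Orthogonality of the subspaces does not mention the weights, so it links the two Gram
   matrices. *)
- move=> G1; apply: orthogonal_gram_identity (fun=> ltr01) DC0 oneD _ => //.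
  exact: gram_identity_orthogonal w0 D0 wD G1.
- move=> G1.
  have oW : pairwise_orthogonal_subspaces (ip := ip) (W := W).
    exact: gram_identity_orthogonal (fun=> ltr01) DC0 oneD G1.
  split; last by split.
  split; first by split.
  (* The Riesz bounds serve as frame bounds: [D] by the Bessel inequality, [C] by approximate
     Parseval and [wC], with error [e / C] so that multiplying by [C] leaves [e]. *)
  exists C, D; split => // x.
  have [||s [us sJ sD]] := @ge0_bounded_has_sum R k I
    (fun i => w i ^+ 2 * `|proj ip (W i) x| ^+ 2) (D * `|x| ^+ 2).
  + by move=> i; rewrite mulr_ge0 ?exprn_ge0// ltW.
  + by move=> J; apply: bessel_bound w0 D0 wD J x.
  exists s; rewrite // sD andbT; apply/ler_addgt0Pl => e e0.
  have eC0 : 0 < e / C by rewrite divr_gt0.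
  have [J xJ] := orthogonal_direct_sum_approx H_hilbert cW x eC0 oW W_dense.
  apply: le_trans (ler_wpM2l (ltW C0) xJ) _.
  rewrite mulrDr mulrC divfK ?gt_eqF// lerD2l; apply: le_trans (sJ J).
  rewrite mulr_sumr; apply: ler_sum => i _; apply: wC.
  exact: proj_in.
Qed.
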